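(* Let $\phi(x)=|1-1/x|$ for all $x>0$. Then for any given countably infinite subset $X$ of points (rational or irrational) in $(0,\infty)$, there exists a dense unbounded uncountable invariant $\infty$-scrambled set $Y$ of totally transitive irrational points in $(0,\infty)$ such that, for any $x$ in $X$ and any $y$ in $Y$, we have $$\limsup_{n\to\infty}|\phi^n(x)-\phi^n(y)|=\infty\quad\text{and}\quad\liminf_{n\to\infty}|\phi^n(x)-\phi^n(y)|=0.$$
   Context: The map $\phi$ is regarded as a continuous map from the compactification $[0,\infty]$ of $[0,\infty)$ onto itself, with $\phi(0)=\infty$ and $\phi(\infty)=1$; $\phi^n$ is the $n$-th iterate. (Every rational point of $[0,\infty)$ is mapped to $0$ after finitely many iterations, while irrational points of $(0,\infty)$ are mapped to irrational points of $(0,\infty)$.) Convention: $|\pm\infty\pm r|=\infty$ for every real number $r$, and $\infty>r$ for every real number $r$. A set $S$ is an $\infty$-scrambled set of $\phi$ if for any $x\ne y$ in $S$, $\limsup_{n\to\infty}|\phi^n(x)-\phi^n(y)|\ge\delta$ for every $\delta>0$ (i.e. the limsup is $\infty$) and $\liminf_{n\to\infty}|\phi^n(x)-\phi^n(y)|=0$. $S$ is invariant if $\phi(S)\subset S$. A point $y\in(0,\infty)$ is totally transitive if for each integer $n\ge1$ the orbit of $y$ under $\phi^n$, namely $\{\phi^{nj}(y):j\ge0\}$, is dense in $(0,\infty)$. ''Dense'' for $Y$ means dense in $(0,\infty)$. *)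

(* Defs.v *)
From mathcomp Require Import all_boot all_order all_algebra.
From mathcomp Require Import all_classical all_reals all_analysis.

Set Implicit Arguments.
Unset Strict Implicit.
Unset Printing Implicit Defensive.

Import Order.TTheory GRing.Theory Num.Theory.
Import numFieldNormedType.Exports.

Local Open Scope classical_set_scope.
Local Open Scope ring_scope.
Local Open Scope ereal_scope.

(* The map of [0, +oo] onto itself, as a total function on \bar R; its values
   at negative arguments are never used.  Since 0^-1 = +oo and +oo^-1 = 0 in
   \bar R, the formula also gives the values at the endpoints (phi0, phiy). *)
Definition phi {R : realType} (x : \bar R) : \bar R := `|1 - x^-1|.

Lemma phi_pos (R : realType) (r : R) :
  (0 < r)%R -> phi r%:E = `|1 - r^-1|%R%:E.
Proof. by move=> r0; rewrite /phi inver gt_eqF. Qed.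

Lemma phi0 (R : realType) : phi 0 = +oo :> \bar R.
Proof. by rewrite /phi inver eqxx. Qed.

Lemma phiy (R : realType) : phi +oo = 1 :> \bar R.
Proof. by rewrite /phi invey sube0 abse1. Qed.

(* In \bar R, `|+oo - r| = `|r - +oo| = +oo for r real. *)
Definition orbit_dist {R : realType} (x y : \bar R) : (\bar R)^nat :=
  fun n => `|iter n phi x - iter n phi y|.

Definition infty_scrambled {R : realType} (S : set (\bar R)) : Prop :=
  forall x y, S x -> S y -> x <> y ->
    (forall delta : R, (0 < delta)%R ->
       delta%:E <= limn_esup (orbit_dist x y)) /\
    limn_einf (orbit_dist x y) = 0.

Definition phi_invariant {R : realType} (S : set (\bar R)) : Prop :=
  phi @` S `<=` S.

(* A is not required to be contained in ]0, +oo[. *)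
Definition dense_in_pos {R : realType} (A : set R) : Prop :=
  `]0%R, +oo[ `<=` closure A.

(* The preimage under EFin is the set of finite points of the orbit. *)
Definition totally_transitive {R : realType} (y : R) : Prop :=
  forall n : nat, (0 < n)%N ->
    dense_in_pos (EFin @^-1` [set iter (n * j)%N phi y%:E | j in [set: nat]]).

(* Main.v *)
Require Import Defs.
From mathcomp Require Import all_boot all_order all_algebra.
From mathcomp Require Import all_classical all_reals all_analysis.
From mathcomp Require Import borel_hierarchy.
From mathcomp Require Import ring lra.

Set Implicit Arguments.
Unset Strict Implicit.
Unset Printing Implicit Defensive.

Import Order.TTheory GRing.Theory Num.Theory.
Import numFieldNormedType.Exports.
Local Open Scope classical_set_scope.
Local Open Scope ring_scope.

(** Write f = [phiR] for the real map x |-> |1 - 1/x|.  The theorem rests on one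
    property of f: it is locally eventually onto, i.e. all large iterates of f
    map every nonempty open subset of ]0, +oo[ onto a set containing ]0, +oo[
    ([open_eventually_onto]).  The proof is Euclid's algorithm run backwards.
    The inverse branches v |-> 1/(1+v) of f and v |-> 1 + 1/v of f^2 reach every
    positive rational from 0 in finitely many steps.  So it suffices to treat a
    neighbourhood of 0, which f turns into a neighbourhood of +oo; and f^3
    maps ]t, +oo[ onto a set containing all positive points of ]t - 2, +oo[.

    Consequently, if W n is a neighbourhood of some positive point for
    arbitrarily large n, the points y with f^n(y) in W n for some n form a
    comeager set ([comeager_hitting]): inside any open set the n-th iterate can
    be given any positive value.  Besides irrationality, each requirement on y
    is a countable conjunction of such hitting conditions:
    - total transitivity: f^(mj+i)(y) visits every rational interval;
    - for any point x of [0, +oo], |phi^n(x) - f^n(f^j(y))| takes both small and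
      large values for arbitrarily large n: when phi^n(x) is finite, which
      happens at least every second time, aim near it, respectively far from it;
    - the same for f^i(y) against f^j(y) with i < j: aim near the fixed point
      of f for small distances, and at a point z < 1 with f^(j-i)(z) large for
      large distances.

    Baire's theorem then says that, given countably many points, some irrational
    y is in the required relation with all of them.  Hence a set S of generic
    points that is maximal, by Zorn's lemma, among those whose points are
    pairwise in relation (all iterates of one against all iterates of the other)
    cannot be countable ([comeager_uncountable_independent]).  The union Y of
    the orbits of S is invariant, and it is dense, hence unbounded, because it
    contains a dense orbit. *)

(** * Inverse branches and the Euclidean algorithm *)

(** On the reals this differs from [phi] only at 0, where it is 1 instead of
    +oo.  The orbit of a positive irrational avoids 0 ([iter_phi_EFin]). *)
Definition phiR {R : realType} (x : R) : R := `|1 - x^-1|.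

(** The inverse of [phiR] on ]0, 1[. *)
Definition low_branch {R : realType} (v : R) : R := (1 + v)^-1.

(** On ]1, +oo[ it is the second iterate of [phiR] that covers ]0, +oo[; this is
    its inverse there. *)
Definition high_branch {R : realType} (v : R) : R := 1 + v^-1.

(** Only positive preimages count: [phiR] is total, but the dynamics under study
    is that on ]0, +oo[. *)
Definition eventually_onto {R : realType} (U : set R) : Prop :=
  exists K : nat, forall n, (K <= n)%N -> forall z : R, 0 < z ->
    exists2 y, U y /\ 0 < y & iter n phiR y = z.

Lemma low_branch_gt0 (R : realType) (v : R) : 0 <= v -> 0 < low_branch v.
Proof. by move=> v0; rewrite invr_gt0 ltr_wpDr. Qed.

Lemma high_branch_gt0 (R : realType) (v : R) : 0 < v -> 0 < high_branch v.
Proof. by move=> v0; rewrite addr_gt0 ?invr_gt0. Qed.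

Lemma phiR_low (R : realType) (v : R) : 0 <= v -> phiR (low_branch v) = v.
Proof.
by move=> v0; rewrite /phiR invrK opprD addrA subrr sub0r normrN ger0_norm.
Qed.

Lemma phiR_high (R : realType) (v : R) :
  0 < v -> phiR (high_branch v) = low_branch v.
Proof.
move=> v0; rewrite /phiR /high_branch /low_branch.
have -> : 1 - (1 + v^-1)^-1 = (1 + v)^-1.
  by field; rewrite ?[_ + 1]addrC !gt_eqF ?addr_gt0.
by rewrite ger0_norm// invr_ge0 addr_ge0// ltW.
Qed.

Lemma eventually_onto_low (R : realType) (U : set R) :
  eventually_onto (low_branch @^-1` U) -> eventually_onto U.
Proof.
move=> [K onto]; exists K.+1 => -[//|n] Kn z z0.
have [v [Uv v0] vz] := onto n Kn z z0.
exists (low_branch v); first by split=> //; exact/low_branch_gt0/ltW.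
by rewrite iterSr phiR_low// ltW.
Qed.

Lemma eventually_onto_high (R : realType) (U : set R) :
  eventually_onto (high_branch @^-1` U) -> eventually_onto U.
Proof.
move=> [K onto]; exists K.+2 => -[//|[//|n]] Kn z z0.
have [v [Uv v0] vz] := onto n Kn z z0.
exists (high_branch v); first by split=> //; exact/high_branch_gt0.
by rewrite !iterSr phiR_high// phiR_low// ltW.
Qed.

Lemma eventually_ontoS (R : realType) (U V : set R) :
  (forall y, 0 < y -> U y -> V y) -> eventually_onto U -> eventually_onto V.
Proof.
move=> UV [K onto]; exists K => n Kn z z0.
by have [v [Uv v0] vz] := onto n Kn z z0; exists v => //; split=> //; exact: UV.
Qed.

Lemma eventually_ontoT (R : realType) : eventually_onto [set: R].
Proof.
exists 0%N => n _ z z0; elim: n z z0 => [|n ih] z z0; first by exists z.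
have [y [_ y0] yz] := ih _ (low_branch_gt0 (ltW z0)).
by exists y => //=; rewrite yz phiR_low// ltW.
Qed.

(** [high_branch] after [low_branch] is v |-> v + 2, so finitely many pull-backs
    reduce ]t, +oo[ to a half-line containing all of ]0, +oo[. *)
Lemma eventually_onto_gt (R : realType) (t : R) :
  eventually_onto [set y | t < y].
Proof.
have [n] : exists n : nat, t <= n.*2%:R.
  exists (Num.bound `|t|); apply: le_trans (ler_norm _) _.
  apply: le_trans (ltW (archi_boundP _)) _ => //.
  by rewrite ler_nat -addnn leq_addr.
elim: n t => [|n ih] t tn.
  apply: eventually_ontoS (@eventually_ontoT R) => y y0 _ /=.
  exact: le_lt_trans y0.
have tn2 : t - 2 <= n.*2%:R.
  by rewrite lerBlDr (le_trans tn)// -natrD ler_nat doubleS addn2.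
apply: eventually_onto_high; apply: eventually_onto_low.
apply: eventually_ontoS (ih _ tn2) => y y0 /=.
by rewrite /high_branch /low_branch invrK; lra.
Qed.

Lemma cvg_low_branch (R : realType) (x : R) : 0 <= x ->
  low_branch @ x --> low_branch x.
Proof.
move=> x0; apply: cvgV; first by rewrite gt_eqF// ltr_wpDr.
by apply: cvgD; [exact: cvg_cst|exact: cvg_id].
Qed.

Lemma cvg_high_branch (R : realType) (x : R) : 0 < x ->
  high_branch @ x --> high_branch x.
Proof.
move=> x0; apply: cvgD; first exact: cvg_cst.
by apply: cvgV; [rewrite gt_eqF|exact: cvg_id].
Qed.

(** Subtractive Euclid: p/q is [low_branch] of (q - p)/p if p <= q, and
    [high_branch] of q/(p - q) if q < p.  Both branches are continuous, so a
    neighbourhood of p/q pulls back to a neighbourhood of a fraction with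
    smaller p + q.  The descent ends at p = 0. *)
Lemma eventually_onto_nbhs_rat (R : realType) (p q : nat) (U : set R) :
  (0 < q)%N -> nbhs (p%:R / q%:R : R) U -> eventually_onto U.
Proof.
have [n] := ubnP (p + q); elim: n p q U => // n ih p q U pqn q0 nU.
have qR : 0 < q%:R :> R by rewrite ltr0n.
have [p0|p0] := posnP p.
  apply: eventually_onto_low.
  move: nU; rewrite p0 mul0r => -[e /= e0 eU].
  (* 1 / (1 + y) tends to 0 as y tends to +oo *)
  apply: eventually_ontoS (eventually_onto_gt e^-1) => y y0 /= ey.
  apply: eU => /=; rewrite sub0r normrN gtr0_norm ?low_branch_gt0 ?ltW//.
  rewrite /low_branch invf_plt ?posrE ?addr_gt0//.
  by rewrite (lt_trans ey)// ltrDr.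
have pR : 0 < p%:R :> R by rewrite ltr0n.
have [pq|qp] := leqP p q.
  apply: eventually_onto_low; apply: (ih (q - p)%N p) => //.
    rewrite subnK//; move: pqn; rewrite ltnS; apply: leq_trans.
    by rewrite -add1n leq_add2r.
  have lowE : low_branch ((q - p)%:R / p%:R) = p%:R / q%:R :> R.
    by rewrite /low_branch natrB//; field; rewrite !gt_eqF.
  apply: (cvg_low_branch _ : {for _, continuous low_branch}).
    by rewrite divr_ge0.
  by rewrite lowE.
apply: eventually_onto_high; apply: (ih q (p - q)%N).
- rewrite subnKC ?(ltnW qp)//; move: pqn; rewrite ltnS; apply: leq_trans.
  by rewrite -addn1 leq_add2l.
- by rewrite subn_gt0.
- have pqR : 0 < p%:R - q%:R :> R by rewrite subr_gt0 ltr_nat.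
  have highE : high_branch (q%:R / (p - q)%:R) = p%:R / q%:R :> R.
    by rewrite /high_branch natrB ?(ltnW qp)//; field; rewrite !gt_eqF.
  apply: (cvg_high_branch _ : {for _, continuous high_branch}).
    by rewrite divr_gt0// natrB ?(ltnW qp).
  by rewrite highE.
Qed.

Lemma open_eventually_onto (R : realType) (O : set R) (x : R) :
  open O -> O x -> 0 < x -> eventually_onto O.
Proof.
move=> oO Ox x0.
have oP : open [set y : R | 0 < y] by exact: open_gt.
have [|r [[Or /= r0] [q _ qr]]] := @dense_rat R _ _ (openI oO oP).
  by exists x.
apply: (@eventually_onto_nbhs_rat _ `|numq q|%N `|denq q|%N).
  by rewrite absz_gt0 denq_eq0.
suff -> : `|numq q|%:R / `|denq q|%:R = r by exact: open_nbhs_nbhs.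
rewrite -qr ltr0q in r0.
rewrite -qr -[q in RHS]divq_num_den fmorph_div/= !ratr_int.
by rewrite !pmulrn !gez0_abs// ltW// ?denq_gt0// numq_gt0.
Qed.

(** * Comeager sets *)

(** The dense open sets are indexed by themselves, so that countable
    intersections of comeager sets need no re-enumeration. *)
Definition comeager {R : realType} (P : set R) : Prop :=
  exists2 F : set (set R),
    countable F /\ (forall A, F A -> open A /\ dense A) &
    \bigcap_(A in F) A `<=` P.

Lemma comeager_dense (R : realType) (P : set R) : comeager P -> dense P.
Proof.
move=> [F [cF odF] FP].
have /pcard_surjP[g gF] : (F #<= [set: nat])%card by [].
pose G n := if `[< F (g n) >] then g n else setT.
have /Baire dG n : open (G n) /\ dense (G n).
  rewrite /G; case: asboolP => [/odF//|_].
  by split; [exact: openT|move=> O O0 _; rewrite setIT].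
move=> O O0 oO; have [x [Ox Gx]] := dG O O0 oO.
exists x; split=> //; apply: FP => A FA.
have [n _ gnA] := gF _ FA; have := Gx n I.
by rewrite /G gnA asboolT.
Qed.

Lemma comeagerS (R : realType) (P Q : set R) :
  P `<=` Q -> comeager P -> comeager Q.
Proof. by move=> PQ [F odF FP]; exists F => //; exact: subset_trans PQ. Qed.

Lemma comeager_bigcap (R : realType) (T : Type) (D : set T) (P : T -> set R) :
  countable D -> (forall i, D i -> comeager (P i)) ->
  comeager (\bigcap_(i in D) P i).
Proof.
move=> cD cP.
have /choice[F FP] i : exists F : set (set R), D i ->
    (countable F /\ (forall A, F A -> open A /\ dense A)) /\
    \bigcap_(A in F) A `<=` P i.
  have [Di|nDi] := pselect (D i); last by exists set0.
  by have [F odF FP] := cP i Di; exists F.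
exists (\bigcup_(i in D) F i).
  split; first by apply: bigcup_countable => // i /FP[[]].
  by move=> A [i Di FiA]; have [[_ +] _] := FP i Di; apply.
move=> x Fx i Di; have [_] := FP i Di; apply=> A FiA.
by apply: Fx; exists i.
Qed.

Lemma comeagerI (R : realType) (P Q : set R) :
  comeager P -> comeager Q -> comeager (P `&` Q).
Proof.
move=> cP cQ.
apply: (comeagerS _ (comeager_bigcap (P := fun b => if b then P else Q)
  (countableP [set: bool]) _)) => [x PQx|[]//].
by split; [exact: (PQx true I)|exact: (PQx false I)].
Qed.

Lemma comeager_irrational (R : realType) : comeager (@irrational R).
Proof.
have [F odF ->] := @irrational_Gdelta R.
exists (range F); last by move=> x Fx n _; apply: Fx; exists n.
split; first exact: sub_countable (card_image_le _ _) (countableP _).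
by move=> _ [n _ <-].
Qed.

(** * Orbits of irrational points *)
Lemma phiR_rational (R : realType) (x : R) : rational x -> rational (phiR x).
Proof.
move=> [q _ <-]; exists `|1 - q^-1| => //.
by rewrite /phiR ratr_norm rmorphB/= fmorphV rmorph1.
Qed.

Lemma phiR_irrational (R : realType) (x : R) :
  irrational x -> irrational (phiR x).
Proof.
move=> ix [q _ qx]; apply: ix.
suff [r rx] : exists r : rat, ratr r = 1 - x^-1.
  exists (1 - r)^-1 => //.
  by rewrite fmorphV rmorphB/= rmorph1 rx opprB addrCA subrr addr0 invrK.
have [x0|x0] := lerP 0 (1 - x^-1).
  by exists q; rewrite qx /phiR ger0_norm.
by exists (- q); rewrite rmorphN/= qx /phiR ltr0_norm// opprK.
Qed.

Lemma irrational_neq0 (R : realType) (x : R) : irrational x -> x != 0.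
Proof.
by move=> ix; apply/eqP => x0; apply: ix; exists 0; rewrite ?rmorph0.
Qed.

(** Irrationality passes both ways.  From left to right, irrational orbits avoid
    0, the only point where [phiR] is discontinuous; from right to left, an
    irrational value for an iterate forces the starting point to be
    irrational. *)
Lemma iter_phiR_irrational (R : realType) (n : nat) (x : R) :
  irrational x <-> irrational (iter n phiR x).
Proof.
elim: n => [|n [ih1 ih2]]; first by split.
split=> [/ih1|]; first exact: phiR_irrational.
by move=> ix; apply: ih2 => /phiR_rational.
Qed.

Lemma iter_phiR_gt0 (R : realType) (n : nat) (x : R) :
  0 < x -> irrational x -> 0 < iter n phiR x.
Proof.
move=> x0 /(iter_phiR_irrational n) ix.
rewrite lt_neqAle eq_sym irrational_neq0//=.
by case: n ix => [|n] _ /=; [exact: ltW|exact: normr_ge0].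
Qed.

Lemma iter_phi_EFin (R : realType) (n : nat) (x : R) :
  0 < x -> irrational x -> iter n phi x%:E = (iter n phiR x)%:E.
Proof.
move=> x0 ix; elim: n => //= n ->.
by rewrite phi_pos// iter_phiR_gt0.
Qed.

Lemma continuous_iter_phiR (R : realType) (k : nat) (x : R) :
  (forall i, (i < k)%N -> iter i phiR x != 0) ->
  {for x, continuous (iter k phiR)}.
Proof.
elim: k => [|k ih] nz; first exact: cvg_id.
apply: cvg_norm; apply: cvgB; first exact: cvg_cst.
apply: cvgV; first exact: nz.
by apply: ih => i ik; apply: nz; rewrite ltnW.
Qed.

(** * Hitting conditions are generic *)

(** Every requirement on the points of Y, irrationality excepted, reduces to
    this lemma.  Inside an open set O choose y with f^n(y) equal to an irrational
    point of W n; then y is irrational, f^n is continuous at y, and the condition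
    holds on a whole neighbourhood of y. *)
Lemma comeager_hitting (R : realType) (W : nat -> set R) :
  (forall K : nat, exists n (z : R), [/\ (K <= n)%N, 0 < z & nbhs z (W n)]) ->
  comeager [set y | 0 < y -> exists n, W n (iter n phiR y)].
Proof.
move=> io_W; set P := [set y | _].
suff dP : dense P°.
  exists [set P°]; last by move=> x /(_ _ erefl)/interior_subset.
  split; first exact/finite_set_countable.
  by move=> _ ->; split=> //; exact: open_interior.
move=> O [u Ou] oO.
(* the condition is void on an open set without positive points *)
have [[x [Ox x0]]|noO] := pselect (exists x, O x /\ 0 < x); last first.
  exists u; split=> //; apply: filterS (open_nbhs_nbhs (conj oO Ou)).
  by move=> y Oy y0; exfalso; apply: noO; exists y.
have [K onto] := open_eventually_onto oO Ox x0.
have [n [z [Kn z0 Wz]]] := io_W K.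
have oWp : open ((W n)° `&` [set y | 0 < y]).
  by apply: openI; [exact: open_interior|exact: open_gt].
have [|z' [[Wz' /= z'0] iz']] :=
  comeager_dense (@comeager_irrational R) _ oWp; first by exists z.
have [y [Oy y0] yz'] := onto n Kn z' z'0.
have iy : irrational y by apply/(iter_phiR_irrational n); rewrite yz'.
have cont_y : {for y, continuous (iter n phiR)}.
  by apply: continuous_iter_phiR => i _; rewrite gt_eqF// iter_phiR_gt0.
exists y; split=> //; have : nbhs (iter n phiR y) (W n) by rewrite yz'.
by move=> /cont_y; apply: (@filterS _ (nbhs y)) => v Wv _; exists n.
Qed.

(** * Uncountable independent sets *)
Lemma comeager_neq (R : realType) (x : R) : comeager [set y | x <> y].
Proof.
exists [set ~` [set x]]; last by move=> y /(_ _ erefl) xy /esym.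
split=> [|_ ->]; first exact/finite_set_countable.
split; last exact: dense_set1C.
by rewrite openC; exact/accessible_closed_set1/hausdorff_accessible/Rhausdorff.
Qed.

(** A set maximal among the subsets of G that are pairwise related cannot be
    countable: by Baire's theorem some positive point of G would be related to,
    and distinct from, all its points, and could be added to it. *)
Lemma comeager_uncountable_independent (R : realType) (G : set R)
    (rel : R -> R -> Prop) :
  (forall x y, rel x y -> rel y x) ->
  comeager [set y | 0 < y -> G y] ->
  (forall x, comeager [set y | 0 < y -> rel x y]) ->
  exists S : set R, [/\ S `<=` G, ~ countable S &
    forall x y, S x -> S y -> x <> y -> rel x y].
Proof.
move=> relC cG crel.
pose P S := S `<=` G /\ forall x y, S x -> S y -> x <> y -> rel x y.
have [F FP Ftot|S [[SG Srel] Smax]] := @Zorn_bigcup _ P.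
  split=> [x [A FA Ax]|x y [A FA Ax] [B FB By]].
    by have [+ _] := FP _ FA; apply.
  have [AB|BA] := Ftot _ _ FA FB.
    by have [_] := FP _ FB; apply=> //; exact: AB.
  by have [_] := FP _ FA; apply=> //; exact: BA.
exists S; split=> // cS.
have cN : comeager [set y | 0 < y -> G y /\
    forall x, S x -> x <> y /\ rel x y].
  have := comeagerI cG (comeager_bigcap cS
    (fun x _ => comeagerI (comeager_neq x) (crel x))).
  apply: comeagerS => y [Gy Sy] y0.
  split=> [|x /Sy[/= xy rxy]]; first exact: Gy.
  by split=> //; exact: rxy.
have [|y [/= y0 /(_ y0)[Gy Sy]]] :=
  comeager_dense cN _ (@open_gt R 0); first by exists 1 => /=.
apply: (Smax (S `|` [set y])).
  split; first exact: subsetUl.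
  by move=> SyS; have [] := Sy y (SyS y (or_intror erefl)).
split=> [x [/SG//|->//]|x z [Sx|->] [Sz|->] xz //].
- exact: Srel.
- by have [] := Sy x Sx.
- by apply: relC; have [] := Sy z Sz.
Qed.

(** * Oscillating pairs *)

(** The conclusion limsup = +oo and liminf = 0 for the distance of two orbits,
    in a form that is a countable conjunction of hitting conditions. *)
Definition oscillating {R : realType} (x y : \bar R) : Prop :=
  forall N k : nat,
    (exists2 n, (N <= n)%N & (orbit_dist x y n < (k.+1%:R^-1)%:E)%E) /\
    (exists2 n, (N <= n)%N & (k%:R%:E < orbit_dist x y n)%E).

Lemma oscillatingC (R : realType) (x y : \bar R) :
  oscillating x y -> oscillating y x.
Proof.
have distC n : orbit_dist y x n = orbit_dist x y n.
  rewrite /orbit_dist; case: (iter n phi x) (iter n phi y) => [r| |] [t| |] //=.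
  by rewrite distrC.
move=> osc N k; have [[n Nn dn] [m Nm dm]] := osc N k.
by split; [exists n|exists m]; rewrite ?distC.
Qed.

Lemma oscillating_limn_esup (R : realType) (x y : \bar R) :
  oscillating x y -> limn_esup (orbit_dist x y) = +oo%E.
Proof.
move=> osc; rewrite limn_esup_lim.
suff -> : esups (orbit_dist x y) = fun=> +oo%E by exact/lim_cst/ereal_hausdorff.
apply/funext => N; apply/eqyP => A A0.
have [_ [n Nn dn]] := osc N (Num.bound A).
apply: (@le_trans _ _ (orbit_dist x y n)).
  by apply: le_trans (ltW dn); rewrite lee_fin ltW// archi_boundP// ltW.
by apply: ereal_sup_ubound; exists n.
Qed.

Lemma oscillating_limn_einf (R : realType) (x y : \bar R) :
  oscillating x y -> limn_einf (orbit_dist x y) = 0%E.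
Proof.
move=> osc; rewrite limn_einf_lim.
suff -> : einfs (orbit_dist x y) = fun=> 0%E by exact/lim_cst/ereal_hausdorff.
apply/funext => N; apply/eqP; rewrite eq_le; apply/andP; split; last first.
  by apply: le_ereal_inf_tmp => _ [n _ <-]; exact: abse_ge0.
apply/lee_addgt0Pr => e e0; rewrite add0e.
have [[n Nn dn] _] := osc N (Num.bound e^-1).
apply: (@le_trans _ _ (orbit_dist x y n)).
  by apply: ereal_inf_lbound; exists n.
apply: le_trans (ltW dn) _; rewrite lee_fin invf_ple ?posrE//.
apply: le_trans (ltW (archi_boundP _)) _; first by rewrite invr_ge0 ltW.
by rewrite ler_nat.
Qed.

(** [D n v] stands for the distance at time n as a function of the value v of
    the orbit of y at time n + j. *)
Lemma comeager_near_far (R : realType) (D : nat -> R -> \bar R) (j : nat) :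
  (forall N k : nat, exists n (z : R), [/\ (N <= n)%N, 0 < z &
     \forall v \near z, (D n v < (k.+1%:R^-1)%:E)%E]) ->
  (forall N k : nat, exists n (z : R), [/\ (N <= n)%N, 0 < z &
     \forall v \near z, (k%:R%:E < D n v)%E]) ->
  comeager [set y | 0 < y -> forall N k : nat,
    (exists2 n, (N <= n)%N & (D n (iter (n + j) phiR y) < (k.+1%:R^-1)%:E)%E) /\
    (exists2 n, (N <= n)%N & (k%:R%:E < D n (iter (n + j) phiR y))%E)].
Proof.
move=> Dnear Dfar.
pose W (b : bool) N k m := [set v | exists n, [/\ m = (n + j)%N, (N <= n)%N &
  if b then (D n v < (k.+1%:R^-1)%:E)%E else (k%:R%:E < D n v)%E]].
have cW (p : bool * nat * nat) : setT p -> comeager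
    [set y | 0 < y -> exists n, W p.1.1 p.1.2 p.2 n (iter n phiR y)].
  case: p => -[b N] k _ /=; apply: comeager_hitting => K.
  have [n [z [Nn z0 Wz]]] : exists n (z : R), [/\ (N + K <= n)%N, 0 < z &
      \forall v \near z, if b then (D n v < (k.+1%:R^-1)%:E)%E
                              else (k%:R%:E < D n v)%E].
    by case: b; [exact: Dnear|exact: Dfar].
  (* n was taken beyond N + K to serve both the condition and the lemma *)
  exists (n + j)%N, z; split=> //.
    by rewrite (leq_trans _ (leq_addr _ _))// (leq_trans _ Nn)// leq_addl.
  apply: filterS Wz => v Wv; exists n; split=> //.
  by rewrite (leq_trans _ Nn)// leq_addr.
apply: (comeagerS _ (comeager_bigcap (countableP setT) cW)) => y Wy y0 N k.
split.
  by have [_ [n [-> Nn Dn]]] := Wy (true, N, k) I y0; exists n.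
by have [_ [n [-> Nn Dn]]] := Wy (false, N, k) I y0; exists n.
Qed.

(** Whenever an iterate of [phi] is +oo, the next one is 1. *)
Lemma phi_orbit_finite (R : realType) (x : \bar R) (N : nat) :
  exists n (r : R), [/\ (N <= n)%N, 0 <= r & iter n phi x = r%:E].
Proof.
have : (0 <= iter N.+1 phi x)%E by exact: abse_ge0.
case E : (iter N.+1 phi x) => [r| |]//; rewrite ?lee_fin => r0.
  by exists N.+1, r.
by exists N.+2, 1; split; rewrite ?ler01// ?(leq_trans (leqnSn N))//= -phiy -E.
Qed.

(** The orbit of x may pass through +oo, as it does for rational x; the targets
    are chosen at the times, provided by [phi_orbit_finite], when it is
    finite. *)
Lemma comeager_oscillating (R : realType) (x : \bar R) (j : nat) :
  comeager [set y : R | 0 < y -> oscillating x (iter j phiR y)%:E].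
Proof.
pose D n (v : R) := `|iter n phi x - v%:E|%E.
have cont (r z : R) : (fun v => `|r - v|) @ z --> `|r - z|.
  by apply: cvg_norm; apply: cvgB; [exact: cvg_cst|exact: cvg_id].
apply: (comeagerS _ (comeagerI (@comeager_irrational R)
  (@comeager_near_far R D j _ _))) => [y [iy Dy] y0 N k| |].
- have [[n Nn Dn] [m Nm Dm]] := Dy y0 N k.
  have /(iter_phiR_irrational j) ij := iy.
  have j0 := iter_phiR_gt0 j y0 iy.
  split; [exists n|exists m] => //.
    by rewrite /orbit_dist iter_phi_EFin// -iterD.
  by rewrite /orbit_dist iter_phi_EFin// -iterD.
- move=> N k; have [n [r [Nn r0 xr]]] := phi_orbit_finite x N.
  have e0 : 0 < k.+1%:R^-1 :> R by rewrite invr_gt0.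
  exists n, (r + k.+1%:R^-1 / 2); split=> //.
    by rewrite ltr_wpDl// divr_gt0.
  have : `|r - (r + k.+1%:R^-1 / 2)| < k.+1%:R^-1.
    rewrite opprD addrA subrr sub0r normrN gtr0_norm ?divr_gt0//.
    by rewrite ltr_pdivrMr// ltr_pMr// ltr1n.
  move=> /(cvgr_lt _ (cont _ _)); apply: filterS => v rv.
  by rewrite /D xr -EFinB abse_EFin lte_fin.
- move=> N k; have [n [r [Nn r0 xr]]] := phi_orbit_finite x N.
  exists n, (r + k.+1%:R); split=> //; first by rewrite ltr_wpDl.
  have : k%:R < `|r - (r + k.+1%:R)|.
    by rewrite opprD addrA subrr sub0r normrN gtr0_norm// ltr_nat.
  move=> /(cvgr_gt _ (cont _ _)); apply: filterS => v rv.
  by rewrite /D xr -EFinB abse_EFin lte_fin.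
Qed.

Lemma iter_low_branch_gt0 (R : realType) (k : nat) (v : R) :
  0 < v -> 0 < iter k low_branch v.
Proof. by move=> v0; elim: k => //= k /ltW /low_branch_gt0. Qed.

Lemma iter_phiR_low (R : realType) (i k : nat) (v : R) : 0 < v ->
  iter i phiR (iter (i + k) low_branch v) = iter k low_branch v.
Proof.
move=> v0; elim: i => // i ih.
by rewrite iterSr addSn /= phiR_low ?ih// ltW// iter_low_branch_gt0.
Qed.

Lemma continuous_iter_phiR_low (R : realType) (k : nat) (v : R) : 0 < v ->
  {for iter k low_branch v, continuous (iter k phiR)}.
Proof.
move=> v0; apply: continuous_iter_phiR => i ik.
by rewrite -(subnKC (ltnW ik)) iter_phiR_low// gt_eqF// iter_low_branch_gt0.
Qed.

(** The fixed point of [phiR], here (sqrt 5 - 1) / 2. *)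
Lemma low_branch_fixpoint (R : realType) :
  exists2 g : R, 0 < g & low_branch g = g.
Proof.
have s5 : Num.sqrt 5 ^+ 2 = 5 :> R by rewrite sqr_sqrtr.
have s1 : 1 < Num.sqrt 5 :> R by rewrite -[ltLHS]sqrtr1 ltr_sqrt// ltr1n.
exists ((Num.sqrt 5 - 1) / 2); first by rewrite divr_gt0// subr_gt0.
set s := Num.sqrt 5 in s5 s1 *.
suff : (s - 1) / 2 * (1 + (s - 1) / 2) = 1.
  move=> gE; rewrite /low_branch -[LHS]mul1r -[X in X / _]gE mulfK// gt_eqF//.
  by rewrite addr_gt0// divr_gt0// subr_gt0.
have -> : (s - 1) / 2 * (1 + (s - 1) / 2) = (s ^+ 2 - 1) / 4 by field.
by rewrite s5; lra.
Qed.

(** With k = j - i the distance at time n is |v - f^k(v)|, where v = f^(n+i)(y).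
    It vanishes at the fixed point of f.  It is large at the k-th image z of a
    large w under [low_branch]: there f^k(z) = w while z < 1. *)
Lemma comeager_self_oscillating (R : realType) (i j : nat) : (i < j)%N ->
  comeager [set y : R | 0 < y ->
    oscillating (iter i phiR y)%:E (iter j phiR y)%:E].
Proof.
move=> ij; pose k := (j - i)%N.
pose D (n : nat) (v : R) := `|v - iter k phiR v|%:E.
have cont (z : R) : {for z, continuous (iter k phiR)} ->
    (fun v => `|v - iter k phiR v|) @ z --> `|z - iter k phiR z|.
  by move=> ck; apply: cvg_norm; apply: cvgB; [exact: cvg_id|exact: ck].
apply: (comeagerS _ (comeagerI (@comeager_irrational R)
  (@comeager_near_far R D i _ _))) => [y [iy Dy] y0 N e| |].
- have [[n Nn Dn] [m Nm Dm]] := Dy y0 N e.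
  have distE m' : orbit_dist (iter i phiR y)%:E (iter j phiR y)%:E m' =
      D m' (iter (m' + i) phiR y).
    have /(iter_phiR_irrational i) ii := iy.
    have /(iter_phiR_irrational j) ij' := iy.
    rewrite /orbit_dist !iter_phi_EFin ?iter_phiR_gt0//.
    rewrite -EFinB abse_EFin -!iterD.
    by rewrite /D -iterD addnCA subnK// ltnW.
  by split; [exists n|exists m]; rewrite // distE.
- move=> N e; have [g g0 gE] := low_branch_fixpoint R.
  have lowg : iter k low_branch g = g.
    by elim: (k) => //= k' ->.
  have phig : iter k phiR g = g.
    by rewrite -{1}lowg -[X in iter X low_branch]addn0 iter_phiR_low.
  exists N, g; split=> //.
  have : `|g - iter k phiR g| < e.+1%:R^-1.
    by rewrite phig subrr normr0 invr_gt0.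
  have ck := @continuous_iter_phiR_low _ k _ g0; rewrite lowg in ck.
  move=> /(cvgr_lt _ (cont _ ck)); apply: filterS => v.
  by rewrite /D lte_fin.
- move=> N e; have w0 : 0 < e%:R + 1 :> R by rewrite ltr_wpDl.
  have ck := @continuous_iter_phiR_low _ k _ w0.
  exists N, (iter k low_branch (e%:R + 1)); split=> //.
    exact: iter_low_branch_gt0.
  have z1 : iter k low_branch (e%:R + 1) < 1 :> R.
    have -> : k = k.-1.+1 by rewrite prednK// subn_gt0.
    rewrite /= /low_branch invf_lt1 ?ltrDl ?iter_low_branch_gt0//.
    by rewrite addr_gt0// iter_low_branch_gt0.
  have : e%:R < `|iter k low_branch (e%:R + 1)
                  - iter k phiR (iter k low_branch (e%:R + 1))| :> R.
    rewrite -[X in iter X low_branch]addn0 iter_phiR_low//= addn0.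
    by rewrite distrC; apply: lt_le_trans (ler_norm _); lra.
  move=> /(cvgr_gt _ (cont _ ck)); apply: filterS => v.
  by rewrite /D lte_fin.
Qed.

(** * Total transitivity *)

(** Total transitivity of all iterates of y at once, hence the shift i; rational
    intervals make it a countable conjunction. *)
Definition subsequences_hit {R : realType} (y : R) : Prop :=
  forall (m i : nat) (p q : rat), (0 < m)%N -> 0 < p -> p < q ->
    exists j, ratr p < iter (m * j + i) phiR y < ratr q.

Lemma comeager_subsequences_hit (R : realType) :
  comeager [set y : R | 0 < y -> subsequences_hit y].
Proof.
pose W (m i : nat) (p q : rat) (n : nat) := [set v : R |
  exists j, n = (m * j + i)%N /\ ratr p < v < ratr q].
pose D := [set t : nat * nat * rat * rat |
  [/\ (0 < t.1.1.1)%N, 0 < t.1.2 & t.1.2 < t.2]].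
have cW (t : nat * nat * rat * rat) : D t -> comeager
    [set y | 0 < y -> exists n, W t.1.1.1 t.1.1.2 t.1.2 t.2 n (iter n phiR y)].
  case: t => -[[m i] p] q /= [m0 p0 pq]; apply: comeager_hitting => K.
  have pq' : ratr p < ratr q :> R by rewrite ltr_rat.
  have mid : ((ratr p + ratr q) / 2 : R) \in `]ratr p, ratr q[%R.
    exact: mid_in_itvoo.
  exists (m * K + i)%N, ((ratr p + ratr q) / 2); split.
  - by rewrite (leq_trans _ (leq_addr _ _))// leq_pmull.
  - by rewrite divr_gt0// addr_gt0// ltr0q// (lt_trans p0).
  - have := near_in_itvoo mid; apply: filterS => v; rewrite in_itv/= => pvq.
    by exists K.
apply: (comeagerS _ (comeager_bigcap (countableP D) cW)).
move=> y Wy y0 m i p q m0 p0 pq.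
have [_ [j [-> ?]]] := Wy (m, i, p, q) (And3 m0 p0 pq) y0.
by exists j.
Qed.

Lemma subsequences_hit_transitive (R : realType) (y : R) (i : nat) :
  0 < y -> irrational y -> subsequences_hit y ->
  totally_transitive (iter i phiR y).
Proof.
move=> y0 iy hit m m0 x /=; rewrite in_itv/= andbT => x0 B [e /= e0 eB].
have [p] : exists p : rat, ratr p \in `]x, (x + e)[.
  by apply: rat_in_itvoo; rewrite ltrDl.
rewrite in_itv/= => /andP[xp pe].
have [q] : exists q : rat, ratr q \in `](ratr p : R), (x + e)[.
  exact: rat_in_itvoo.
rewrite in_itv/= => /andP[pq qe].
have [||j /andP[pj jq]] := hit m i p q m0 _ _.
- by rewrite -(ltr0q R) (lt_trans x0).
- by rewrite -(ltr_rat R).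
have xj := lt_trans xp pj; have je := lt_trans jq qe.
exists (iter (m * j + i) phiR y); split.
  exists j => //; rewrite iter_phi_EFin ?iterD//; first exact: iter_phiR_gt0.
  by have /(iter_phiR_irrational i) := iy.
apply: eB => /=; rewrite distrC gtr0_norm ?subr_gt0//.
by rewrite ltrBlDl.
Qed.

Lemma dense_in_pos_unbounded (R : realType) (Y : set R) :
  dense_in_pos Y -> ~ bounded_set Y.
Proof.
move=> dY /ex_strict_bound_gt0[M M0 YM].
have M1 : `]0, +oo[%classic (M + 1) by rewrite /= in_itv/= andbT addr_gt0.
have [y [Yy My]] := dY _ M1 _ (nbhsx_ballx (M + 1) 1 ltr01).
have := YM y Yy; move: My; rewrite /ball/= => My yM.
have := le_lt_trans (ler_norm _) My; have := le_lt_trans (ler_norm _) yM.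
by lra.
Qed.

(** * Generic points and the scrambled set *)
Definition generic {R : realType} (X : set R) (y : R) : Prop :=
  [/\ 0 < y, irrational y, subsequences_hit y,
      (forall i j : nat, (i < j)%N ->
         oscillating (iter i phiR y)%:E (iter j phiR y)%:E) &
      forall x, X x -> forall j : nat,
         oscillating x%:E (iter j phiR y)%:E].

Lemma comeager_generic (R : realType) (X : set R) :
  countable X -> comeager [set y | 0 < y -> generic X y].
Proof.
move=> cX.
have c1 := comeagerI (@comeager_irrational R) (@comeager_subsequences_hit R).
have c2 := comeager_bigcap
  (countableP [set ij : nat * nat | (ij.1 < ij.2)%N])
  (fun ij lt_ij => @comeager_self_oscillating R _ _ lt_ij).
have c3 := comeager_bigcap cX (fun x _ => comeager_bigcap
  (countableP [set: nat]) (fun j _ => @comeager_oscillating R x%:E j)).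
apply: comeagerS (comeagerI c1 (comeagerI c2 c3)).
move=> y [[iy hit] [self other]] y0; split=> //; first exact: hit.
  by move=> i j ij; exact: self (i, j) ij y0.
by move=> x Xx j; exact: other x Xx j I y0.
Qed.

Theorem theorem2 (R : realType) (X : set R)
    (X_pos : X `<=` `]0, +oo[) (X_countably_infinite : (X #= [set: nat])%card) :
  exists Y : set R,
    [/\ Y `<=` `]0, +oo[,
        dense_in_pos Y,
        ~ bounded_set Y,
        ~ countable Y &
        phi_invariant (EFin @` Y)] /\
    [/\ infty_scrambled (EFin @` Y),
        (forall y, Y y -> totally_transitive y),
        (forall y, Y y -> irrational y) &
        (forall x y, X x -> Y y ->
           limn_esup (orbit_dist x%:E y%:E) = +oo%E /\
           limn_einf (orbit_dist x%:E y%:E) = 0%E)].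
Proof.
have cX : countable X by rewrite (eq_countable X_countably_infinite).
pose rel (s t : R) := forall i j : nat,
  oscillating (iter i phiR s)%:E (iter j phiR t)%:E.
have relC s t : rel s t -> rel t s by move=> st i j; exact: oscillatingC.
have crel s : comeager [set t | 0 < t -> rel s t].
  have := comeager_bigcap (countableP [set: nat * nat])
    (fun ij _ => @comeager_oscillating R (iter ij.1 phiR s)%:E ij.2).
  by apply: comeagerS => t st t0 i j; exact: st (i, j) I t0.
have [S [SX ncS Srel]] :=
  comeager_uncountable_independent relC (comeager_generic cX) crel.
pose Y := [set y : R | exists2 s, S s & exists i : nat, y = iter i phiR s].
have SY : S `<=` Y by move=> s Ss; exists s => //; exists 0%N.
have Y_tt y : Y y -> totally_transitive y.
  move=> [s /SX[s0 irs hits _ _] [i ->]].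
  exact: subsequences_hit_transitive.
have dY : dense_in_pos Y.
  have [s Ss] : S !=set0.
    by apply/set0P; apply: contra_notN ncS => /eqP ->; exact: countable0.
  have [s0 irs _ _ _] := SX s Ss.
  apply: subset_trans (Y_tt s (SY s Ss) 1%N isT) _.
  apply: closure_subset => y [j _]; rewrite mul1n iter_phi_EFin// => -[<-].
  by exists s => //; exists j.
exists Y; split.
  split=> //.
  - move=> _ [s /SX[s0 irs _ _ _] [i ->]].
    by rewrite /= in_itv/= andbT iter_phiR_gt0.
  - exact: dense_in_pos_unbounded.
  - by apply: contra_not ncS; apply: sub_countable; exact: subset_card_le.
  - move=> _ [_ [_ [s Ss [i ->]] <-] <-]; have [s0 irs _ _ _] := SX s Ss.
    exists (iter i.+1 phiR s); first by exists s => //; exists i.+1.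
    by rewrite -!iter_phi_EFin.
split=> //.
- move=> _ _ [_ [s Ss [i ->]] <-] [_ [t St [j ->]] <-] neq.
  suff osc : oscillating (iter i phiR s)%:E (iter j phiR t)%:E.
    split; last exact: oscillating_limn_einf.
    by move=> d _; rewrite oscillating_limn_esup// leey.
  have [st|/eqP st] := eqVneq s t; last exact: Srel.
  rewrite -{}st in neq *; have [_ _ _ self _] := SX s Ss.
  have [ij|ji|ij] := ltngtP i j; first exact: self.
    by apply: oscillatingC; exact: self.
  by rewrite ij in neq.
- move=> _ [s /SX[_ irs _ _ _] [i ->]].
  by have /(iter_phiR_irrational i) := irs.
- move=> x _ Xx [s /SX[_ _ _ _ oscX] [i ->]].
  by split; [apply: oscillating_limn_esup|apply: oscillating_limn_einf];
    exact: oscX.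
Qed.
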